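(* Let $n \geq 2$, and let $T$ be an $n$-leaf binary tree. Let $l$ be the level of leaf $1$ (the leftmost leaf) in $T$. Then $|\mathrm{ParseWords}(T, \mathrm{LeftCombTree}(n))| = 2^{l-1}$.
   Context: A binary tree is a rooted ordered tree in which each vertex has either $0$ or $2$ children; its leaves are numbered $1,2,\dots$ from left to right. Let $G$ be the context-free grammar with start symbols $0,1,2$ and rules $0\to 12$, $0\to 21$, $1\to 02$, $1\to 20$, $2\to 01$, $2\to 10$. An $n$-leaf binary tree $T$ parses a word $w$ of length $n$ on $\{0,1,2\}$ if there is a labeling of the vertices of $T$ by $0,1,2$ such that the leaves, from left to right, are labeled with the letters of $w$, and at every internal vertex the label of the vertex together with the labels of its left and right children form a rule of $G$ (i.e. the three labels are pairwise distinct). If $T$ parses $w$, it also parses every word obtained from $w$ by permuting the alphabet $\{0,1,2\}$. For $n$-leaf binary trees $T_1,T_2$, $\mathrm{ParseWords}(T_1,T_2)$ denotes the set of equivalence classes (under permutations of the alphabet $\{0,1,2\}$) of words parsed by both $T_1$ and $T_2$. The level of a vertex is its distance from the root (the root is on level $0$). $\mathrm{LeftCombTree}(n)$ is the $n$-leaf binary tree in which the right child of every internal vertex is a leaf. *)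

(* Defs.v *)
(* MathComp; boolp provides `[< P >], the boolean value of a proposition P. *)
From mathcomp Require Import all_boot all_fingroup boolp.

Set Implicit Arguments.
Unset Strict Implicit.
Unset Printing Implicit Defensive.

Inductive btree := Leaf | Node of btree & btree.

(* A vertex is encoded by its address: the sequence of turns
   (false = left, true = right) on the path from the root to it. *)
Definition vertex := seq bool.
Definition left_child (v : vertex) : vertex := rcons v false.
Definition right_child (v : vertex) : vertex := rcons v true.

(* The distance from the root. *)
Definition level (v : vertex) : nat := size v.

(* Listed from left to right. *)
Fixpoint leaves (T : btree) : seq vertex :=
  if T is Node l r
  then map (cons false) (leaves l) ++ map (cons true) (leaves r)
  else [:: [::]].

Fixpoint internals (T : btree) : seq vertex :=
  if T is Node l r
  then [::] :: map (cons false) (internals l) ++ map (cons true) (internals r)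
  else [::].

Definition nb_leaves (T : btree) : nat := size (leaves T).

(* Leaves are numbered from 1; junk value outside 1 <= i <= nb_leaves T. *)
Definition leaf (T : btree) (i : nat) : vertex := nth [::] (leaves T) i.-1.

Notation letter := 'I_3.

(* grammar_rule a b c : the rule a -> b c belongs to G. *)
Definition grammar_rule (a b c : letter) : bool :=
  (nat_of_ord a, nat_of_ord b, nat_of_ord c) \in
    [:: (0, 1, 2); (0, 2, 1); (1, 0, 2); (1, 2, 0); (2, 0, 1); (2, 1, 0)].

(* Only the values of the labeling at the vertices of T matter. *)
Definition parses (T : btree) (w : seq letter) : Prop :=
  exists lab : vertex -> letter,
    map lab (leaves T) = w /\
    forall v, v \in internals T ->
      grammar_rule (lab v) (lab (left_child v)) (lab (right_child v)).

Definition alphabet_class n (w : n.-tuple letter) : {set n.-tuple letter} :=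
  [set map_tuple s w | s : {perm letter}].

Definition ParseWords n (T1 T2 : btree) : {set {set n.-tuple letter}} :=
  [set alphabet_class w | w : n.-tuple letter & `[< parses T1 w /\ parses T2 w >]].

(* For n >= 1; the two lemmas below say that this is the unique n-leaf tree
   in which every right child is a leaf. *)
Definition LeftCombTree (n : nat) : btree :=
  iter n.-1 (fun T => Node T Leaf) Leaf.

Lemma nb_leaves_LeftCombTree n : 0 < n -> nb_leaves (LeftCombTree n) = n.
Proof.
case: n => // n _; rewrite /LeftCombTree /nb_leaves /=.
by elim: n => //= n IHn; rewrite size_cat size_map IHn addn1.
Qed.

Lemma LeftCombTreeP n (T : btree) : 0 < n -> nb_leaves T = n ->
  (forall v, v \in internals T -> right_child v \in leaves T) <->
  T = LeftCombTree n.
Proof.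
have falseI : injective (cons false) by move=> ? ? [].
have trueI : injective (cons true) by move=> ? ? [].
have memF (s t : seq vertex) v :
    (false :: v \in map (cons false) s ++ map (cons true) t) = (v \in s).
  rewrite mem_cat mem_map //; case: (v \in s) => //=.
  by apply/mapP => -[].
have memT (s t : seq vertex) v :
    (true :: v \in map (cons false) s ++ map (cons true) t) = (v \in t).
  rewrite mem_cat mem_map // orbC; case: (v \in t) => //=.
  by apply/mapP => -[].
have size_gt0 T' : 0 < nb_leaves T'.
  by elim: T' => //= l IHl r _; rewrite /nb_leaves /= size_cat size_map ltn_addr.
move=> n_gt0 sizeT; split; last first.
  move=> ->; case: n {n_gt0 sizeT} => // n; rewrite /LeftCombTree /=.
  elim: n => [|n IHn] v //; rewrite iterS; move: (iter n _ _) IHn => T' IHT'.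
  case: v => [|[] v] vI.
  - exact: (etrans (memT (leaves T') (leaves Leaf) [::])).
  - by have := etrans (esym (memT (internals T') (internals Leaf) v)) vI.
  - have vI' := etrans (esym (memF (internals T') (internals Leaf) v)) vI.
    exact: etrans (memF (leaves T') (leaves Leaf) _) (IHT' v vI').
elim: T n n_gt0 sizeT => [|l IHl r _] n n_gt0 sizeT combT; first by rewrite -sizeT.
have rE : r = Leaf.
  have /= := combT [::] (mem_head _ _); rewrite /right_child /= memT.
  by case: r {sizeT combT} => //= r1 r2; rewrite mem_cat => /orP[] /mapP[].
subst r; move: sizeT; rewrite /nb_leaves /= size_cat size_map addn1 => <-.
rewrite [in LHS](IHl (nb_leaves l)) //; last first.
  move=> v vI; rewrite -(memF (leaves l) (leaves Leaf)); apply: (combT (false :: v)).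
  exact: etrans (memF (internals l) (internals Leaf) v) vI.
by have := size_gt0 l; rewrite /nb_leaves; case: (size (leaves l)).
Qed.

(* Main.v *)
(** The left comb parses [x :: w] when the run that starts in state [x], reads
    the letters of [w] one by one, and moves from state [s] under [c] to the
    letter other than [s] and [c], never meets a letter equal to its state.
    Fix states [s <> e].  By induction on [T], exactly one word parsed by [T]
    leads from [s] to [e]: at [Node L R] the intermediate state has to be the
    third letter.  At the beginning of the word there is no previous state,
    and at [Node L R] the state reached after [L] may be either of the two
    letters other than the final state.  So [2 ^ l] common words end in a
    given state, and there are [3 * 2 ^ l] in all.  The first two letters of
    each differ, so its class has 6 elements. *)

Require Import Defs.
From mathcomp Require Import all_boot all_fingroup boolp zmodp.

Set Implicit Arguments.
Unset Strict Implicit.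
Unset Printing Implicit Defensive.

(* The letter [c] with [a + b + c = 0] modulo 3: the remaining letter when
   [a != b], and [a] itself when [a = b]. *)
Definition third (a b : letter) : letter := inZp (2 * (a + b)).

Lemma grammar_ruleE a b c : grammar_rule a b c = (b != c) && (a == third b c).
Proof.
by case: a b c => [[|[|[|//]]] ?] [[|[|[|//]]] ?] [[|[|[|//]]] ?].
Qed.

(** Distinctness survives any injective renaming of the letters; this form yields the invariance of
    parsing under permutations. *)
Lemma grammar_rule_uniq a b c : grammar_rule a b c = uniq [:: a; b; c].
Proof.
by case: a b c => [[|[|[|//]]] ?] [[|[|[|//]]] ?] [[|[|[|//]]] ?].
Qed.

Lemma thirdC : commutative third.
Proof. by move=> a b; rewrite /third addnC. Qed.

Lemma thirdK a : involutive (third a).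
Proof.
by case: a => [[|[|[|//]]] ?] [[|[|[|//]]] ?]; apply/val_inj.
Qed.

Lemma third_eql a b : (third a b == a) = (a == b).
Proof.
by case: a b => [[|[|[|//]]] ?] [[|[|[|//]]] ?].
Qed.

Lemma third_uniq a b c : a != b -> b != c -> a != c -> b = third a c.
Proof.
by case: a b c => [[|[|[|//]]] ?] [[|[|[|//]]] ?] [[|[|[|//]]] ?] //= *;
  apply/val_inj.
Qed.

(** * Parsing as a recursion on the tree, with the root label explicit *)

Fixpoint derives (T : btree) (e : letter) (w : seq letter) : Prop :=
  if T is Node L R then
    exists a b u v, [/\ w = u ++ v, derives L a u, derives R b v
                      & grammar_rule e a b]
  else w = [:: e].

Lemma derives_labeling T (lab : vertex -> letter) :
  (forall v, v \in internals T ->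
     grammar_rule (lab v) (lab (left_child v)) (lab (right_child v))) ->
  derives T (lab [::]) (map lab (leaves T)).
Proof.
elim: T lab => [|L IHL R IHR] lab //= labP.
exists (lab [:: false]), (lab [:: true]).
exists (map (lab \o cons false) (leaves L)), (map (lab \o cons true) (leaves R)).
split.
- by rewrite map_cat -!map_comp.
- apply: (IHL (lab \o cons false)) => v vI; apply: (labP (false :: v)).
  by rewrite inE mem_cat map_f.
- apply: (IHR (lab \o cons true)) => v vI; apply: (labP (true :: v)).
  by rewrite inE mem_cat (map_f (cons true)) ?orbT.
- exact: (labP [::] (mem_head _ _)).
Qed.

Lemma labeling_derives T e w : derives T e w ->
  exists lab : vertex -> letter, [/\ lab [::] = e, map lab (leaves T) = w &
    forall v, v \in internals T ->
      grammar_rule (lab v) (lab (left_child v)) (lab (right_child v))].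
Proof.
elim: T e w => [|L IHL R IHR] e w /=; first by move=> ->; exists (fun=> e).
move=> [a [b [u [v [-> /IHL[labL [La Lu LP]] /IHR[labR [Rb Rv RP]] eab]]]]].
exists (fun x => if x is c :: y then (if c then labR y else labL y) else e).
split=> //; first by rewrite map_cat -!map_comp -Lu -Rv.
move=> x; rewrite inE mem_cat => /or3P[/eqP->|/mapP[y yL ->]|/mapP[y yR ->]] /=.
- by rewrite La Rb.
- exact: LP.
- exact: RP.
Qed.

Lemma parsesE T w : parses T w <-> exists e, derives T e w.
Proof.
split=> [[lab [<- labP]]|[e /labeling_derives[lab [_ labw labP]]]].
  by exists (lab [::]); apply: derives_labeling.
by exists lab.
Qed.

Lemma parses_perm T w (s : {perm letter}) : parses T w -> parses T (map s w).
Proof.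
move=> [lab [<- labP]]; exists (s \o lab); split; first by rewrite map_comp.
move=> v /labP; rewrite !grammar_rule_uniq => lab_uniq.
by rewrite -(map_inj_uniq (@perm_inj _ s)) in lab_uniq.
Qed.

Lemma derives_size T e w : derives T e w -> size w = nb_leaves T.
Proof.
move=> /labeling_derives[lab [_ <- _]].
by rewrite size_map.
Qed.

Lemma nb_leaves_gt0 T : 0 < nb_leaves T.
Proof.
by elim: T => //= L IHL R _; rewrite /nb_leaves /= size_cat size_map ltn_addr.
Qed.

(** * The left comb as an automaton *)

Fixpoint run (s : letter) (w : seq letter) : option letter :=
  if w is c :: w' then (if s == c then None else run (third s c) w') else Some s.

Definition run0 (w : seq letter) : option letter :=
  if w is c :: w' then run c w' else None.

Lemma run_cat s u v : run s (u ++ v) = obind (run^~ v) (run s u).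
Proof. by elim: u s => //= c u IHu s; case: ifP. Qed.

Lemma run0_cat u v : 0 < size u -> run0 (u ++ v) = obind (run^~ v) (run0 u).
Proof. by case: u => //= c u _; apply: run_cat. Qed.

(** The comb grows at its root, so the induction removes the last letter; the root label of the
    shorter comb is the state before that letter. *)
Lemma derives_LeftComb n e w : size w = n -> 0 < n ->
  derives (LeftCombTree n) e w <-> run0 w = Some e.
Proof.
case: n => // n sizew _; rewrite /LeftCombTree /=.
elim: n e w sizew => [|n IHn] e w sizew /=.
  by case: w sizew => [|c []] //= _; split=> [[->]|[->]].
case/lastP: w sizew => // u c; rewrite size_rcons => -[sizeu].
rewrite -cats1 run0_cat ?sizeu //; split.
  move=> [a [b [u' [v [+ Lu Rv]]]]]; rewrite {v}Rv grammar_ruleE !cats1.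
  move=> /rcons_inj[Eu <-] /andP[/negPf ac /eqP->]; rewrite -Eu in Lu.
  by move/IHn: Lu => -> //=; rewrite ac.
case Eu: (run0 u) => [a|] //=; case: eqVneq => //= ac [<-].
exists a, c, u, [:: c]; split=> //; first exact/IHn.
by rewrite grammar_ruleE ac eqxx.
Qed.

(** * Words that lead from one state to another *)

Fixpoint state_word (T : btree) (s e : letter) : seq letter :=
  if T is Node L R
  then state_word L s (third s e) ++ state_word R (third s e) e
  else [:: third s e].

(** A subtree acts on the state like the single letter at its root, which has to be [third s e] in
    order to move [s] to [e]. *)
Lemma state_wordP T s e x w :
  (derives T x w /\ run s w = Some e) <->
  [/\ s != e, x = third s e & w = state_word T s e].
Proof.
elim: T s e x w => [|L IHL R IHR] s e x w /=.
  split=> [[-> /=]|[se -> ->]] /=.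
    case: eqVneq => //= sx [<-].
    by rewrite thirdK eq_sym third_eql.
  by rewrite eq_sym third_eql (negPf se) thirdK.
split.
  move=> [[a [b [u [v [-> Lu Rv]]]]] + runw]; move: runw.
  rewrite run_cat; case Eu: (run s u) => [m|] //= Ev.
  have [sm -> ->] := (IHL _ _ _ _).1 (conj Lu Eu).
  have [me -> ->] := (IHR _ _ _ _).1 (conj Rv Ev).
  rewrite grammar_ruleE => /andP[neq /eqP->].
  (* If [s = e], both children of the root would have the label [third s m]. *)
  have se : s != e by apply: contraNneq neq => ->; rewrite thirdC.
  have Em := third_uniq sm me se.
  (* With [m = third s e], the left child has the label [e] and the right child the label [s]. *)
  by rewrite -Em; split=> //; rewrite {1 2}Em thirdK (thirdC _ e) (thirdC s) thirdK thirdC.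
move=> [se -> ->]; set m := third s e.
have sm : s != m by rewrite eq_sym third_eql.
have me : m != e by rewrite /m thirdC third_eql eq_sym.
have [Lu Eu] := (IHL s m (third s m) _).2 (And3 sm erefl erefl).
have [Rv Ev] := (IHR m e (third m e) _).2 (And3 me erefl erefl).
split; last by rewrite run_cat Eu.
exists (third s m), (third m e), (state_word L s m), (state_word R m e).
split=> //; rewrite grammar_ruleE /m thirdK (thirdC _ e) (thirdC s) thirdK.
by rewrite thirdC eq_sym se eqxx.
Qed.

(** * Common words with a given final state *)

Definition others (e : letter) : seq letter := [seq m <- enum 'I_3 | m != e].

Lemma size_others e : size (others e) = 2.
Proof.
have := count_predC (pred1 e) (enum 'I_3).
by rewrite count_uniq_mem ?enum_uniq // mem_enum size_enum_ord size_filter => -[].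
Qed.

Fixpoint words (T : btree) (e : letter) : seq (seq letter) :=
  if T is Node L R
  then [seq u ++ state_word R m e | m <- others e, u <- words L m]
  else [:: [:: e]].

(** Here the root label is the final state itself: at a node the left child has some label [m], the
    right child [third m e], and the root gets [e] for either [m != e]. *)
Lemma wordsP T e x w :
  (derives T x w /\ run0 w = Some e) <-> (x = e /\ w \in words T e).
Proof.
elim: T e x w => [|L IHL R IHR] e x w /=.
  by rewrite inE; split=> [[-> [->]]|[-> /eqP->]].
have sizeL a u : derives L a u -> 0 < size u.
  by move/derives_size=> ->; apply: nb_leaves_gt0.
split.
  move=> [[a [b [u [v [-> Lu Rv]]]]] + runw]; move: runw.
  rewrite run0_cat ?(sizeL _ _ Lu) //; case Eu: (run0 u) => [m|] //= Ev.
  have [-> uL] := (IHL _ _ _).1 (conj Lu Eu).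
  have [me -> ->] := (state_wordP _ _ _ _ _).1 (conj Rv Ev).
  rewrite grammar_ruleE thirdK => /andP[_ /eqP->]; split=> //.
  apply/allpairsPdep; exists m, u; split=> //.
  by rewrite mem_filter me mem_enum.
move=> [-> /allpairsPdep[m [u [+ uL ->]]]]; rewrite mem_filter => /andP[me _].
have [Lu Eu] := (IHL _ _ _).2 (conj erefl uL).
have [Rv Ev] := (state_wordP R m e _ _).2 (And3 me erefl erefl).
split; last by rewrite run0_cat ?(sizeL _ _ Lu) // Eu.
exists m, (third m e), u, (state_word R m e); split=> //.
by rewrite grammar_ruleE thirdK eqxx eq_sym third_eql me.
Qed.

(** The number of leaves of [L] fixes where a word is cut, and the run on its left part recovers
    [m]. *)
Lemma words_uniq T e : uniq (words T e).
Proof.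
elim: T e => //= L IHL R _ e; apply: allpairs_uniq_dep => //.
  by rewrite filter_uniq ?enum_uniq.
move=> _ _ /allpairsPdep[m [u [_ uL ->]]] /allpairsPdep[m' [u' [_ uL' ->]]] /=.
have [Lu Eu] := (wordsP _ _ _ _).2 (conj erefl uL); have [Lu' Eu'] := (wordsP _ _ _ _).2 (conj erefl uL').
move/eqP; rewrite eqseq_cat; last by rewrite (derives_size Lu) (derives_size Lu').
move=> /andP[/eqP uu' _]; move: Eu'; rewrite -uu' Eu => -[mm'].
by rewrite mm'.
Qed.

Lemma level_leaf1_Node L R : level (leaf (Node L R) 1) = (level (leaf L 1)).+1.
Proof.
rewrite /leaf /=; have := nb_leaves_gt0 L.
by rewrite /nb_leaves; case: (leaves L).
Qed.

(** Every internal vertex on the path to leaf 1 doubles the count. *)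
Lemma size_words T e : size (words T e) = 2 ^ level (leaf T 1).
Proof.
elim: T e => // L IHL R _ e; rewrite level_leaf1_Node size_allpairs_dep.
rewrite (eq_map IHL) sumnE big_map big_const_seq count_predT iter_addn_0.
by rewrite size_others expnS mulnC.
Qed.

(** * Counting all common words *)

Definition common_words n T : {set n.-tuple letter} :=
  [set w : n.-tuple letter | `[< parses T w /\ parses (LeftCombTree n) w >]].

Lemma common_wordsP n T (w : n.-tuple letter) : 0 < n ->
  reflect (exists e, tval w \in words T e) (w \in common_words n T).
Proof.
move=> n_gt0; rewrite inE; apply: (iffP (asboolP _)).
  move=> [/parsesE[x Tw] /parsesE[e]].
  rewrite derives_LeftComb ?size_tuple // => Ew; exists e.
  by have [] := (wordsP _ _ _ _).1 (conj Tw Ew).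
move=> [e we]; have [Tw Ew] := (wordsP _ _ _ _).2 (conj erefl we).
split; apply/parsesE; exists e => //.
by apply/derives_LeftComb; rewrite ?size_tuple.
Qed.

Lemma card_common_words n T : 0 < n -> nb_leaves T = n ->
  #|common_words n T| = 3 * 2 ^ level (leaf T 1).
Proof.
move=> n_gt0 sizeT; pose s := [seq w | e <- enum 'I_3, w <- words T e].
transitivity (size s); last first.
  rewrite size_allpairs_dep (eq_map (size_words T)).
  rewrite sumnE big_map big_const_seq count_predT iter_addn_0.
  by rewrite size_enum_ord mulnC.
(* The final state of its run tells from which list [words T e] a word comes. *)
have s_uniq : uniq s.
  apply: allpairs_uniq_dep => [|e _|]; rewrite ?enum_uniq ?words_uniq //.
  move=> _ _ /allpairsPdep[e [u [_ uT ->]]] /allpairsPdep[e' [u' [_ uT' ->]]] /=.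
  have [_ Eu] := (wordsP _ _ _ _).2 (conj erefl uT).
  have [_ Eu'] := (wordsP _ _ _ _).2 (conj erefl uT').
  by move=> uu'; move: Eu'; rewrite -uu' Eu => -[->].
rewrite cardE -(size_map val); apply/perm_size/uniq_perm => //.
  by rewrite map_inj_uniq ?enum_uniq //; apply: val_inj.
move=> w; apply/mapP/allpairsPdep => [[t + ->]|[e [u [_ uT ->]]]].
  rewrite mem_enum => /(common_wordsP _ _ n_gt0)[e te].
  by exists e, (val t); rewrite mem_enum.
have [/derives_size + _] := (wordsP _ _ _ _).2 (conj erefl uT).
rewrite sizeT => /eqP sizeu; exists (Tuple sizeu) => //.
by rewrite mem_enum; apply/common_wordsP => //; exists e.
Qed.

(** * Classes under permutations of the alphabet *)

Lemma perm3_eq (s t : {perm letter}) a b :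
  a != b -> s a = t a -> s b = t b -> s = t.
Proof.
move=> ab sta stb; apply/permP => c.
case: (eqVneq c a) => [->//|ca]; case: (eqVneq c b) => [->//|cb].
have image_third (r : {perm letter}) : r c = third (r a) (r b).
  by apply: third_uniq; rewrite (inj_eq perm_inj) // eq_sym.
by rewrite !image_third sta stb.
Qed.

(** A permutation of three letters is determined by its values at [a] and [b], so the 6 permutations
    give 6 different words. *)
Lemma card_alphabet_class n (w : n.-tuple letter) a b :
  a \in w -> b \in w -> a != b -> #|alphabet_class w| = 6.
Proof.
move=> aw bw ab; rewrite /alphabet_class card_imset; first by rewrite card_Sn.
move=> s t /(congr1 val) /= /eq_in_map st.
by apply: (perm3_eq ab); apply: st.
Qed.

Lemma alphabet_class_refl n (w : n.-tuple letter) : w \in alphabet_class w.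
Proof.
apply/imsetP; exists 1%g => //; apply/val_inj => /=.
by rewrite map_id_in // => x _; rewrite perm1.
Qed.

Lemma alphabet_class_sub n (s : {perm letter}) (w : n.-tuple letter) :
  alphabet_class (map_tuple s w) \subset alphabet_class w.
Proof.
apply/subsetP => _ /imsetP[t _ ->]; apply/imsetP; exists (s * t)%g => //.
apply/val_inj => /=; rewrite -map_comp; apply: eq_map => x /=.
by rewrite permM.
Qed.

Lemma alphabet_class_eqP n (u w : n.-tuple letter) :
  (alphabet_class u == alphabet_class w) = (u \in alphabet_class w).
Proof.
apply/eqP/idP => [<-|/imsetP[s _ ->]]; first exact: alphabet_class_refl.
apply/eqP; rewrite eqEsubset alphabet_class_sub /=.
(* Renaming back by the inverse of [s] turns the inclusion already proved into the reverse one. *)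
suff {1}-> : w = map_tuple s^-1%g (map_tuple s w) by apply: alphabet_class_sub.
apply/val_inj; rewrite /= -map_comp map_id_in // => x _ /=.
by rewrite permK.
Qed.

(** The initial state is the first letter, so the run would fail at once on an equal second
    letter. *)
Lemma run0_distinct w e : 1 < size w -> run0 w = Some e ->
  exists a b, [/\ a \in w, b \in w & a != b].
Proof.
case: w => [|a [|b w]] //= _; case: eqVneq => // ab _.
by exists a, b; rewrite !inE !eqxx orbT.
Qed.

Lemma common_words_class n T (w : n.-tuple letter) :
  w \in common_words n T -> alphabet_class w \subset common_words n T.
Proof.
rewrite inE => /asboolP[Tw Cw]; apply/subsetP => _ /imsetP[s _ ->].
by rewrite inE; apply/asboolP; split; apply: parses_perm.
Qed.

(** Common words are grouped by class; since they are closed under renaming, each group is a whole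
    class. *)
Lemma card_common_words_classes n T : 1 < n ->
  #|common_words n T| = #|ParseWords n T (LeftCombTree n)| * 6.
Proof.
move=> n_gt1; have n_gt0 := ltnW n_gt1.
have -> : ParseWords n T (LeftCombTree n) = @alphabet_class n @: common_words n T.
  by apply/setP => c; apply/imsetP/imsetP => -[w wP ->]; exists w => //;
     move: wP; rewrite !inE.
rewrite -sum1_card (partition_big_imset (@alphabet_class n)) /= -sum_nat_const.
apply: eq_bigr => _ /imsetP[w wP ->].
have [e we] := common_wordsP _ _ n_gt0 wP.
have [_ /run0_distinct] := (wordsP _ _ _ _).2 (conj erefl we).
rewrite size_tuple => /(_ n_gt1)[a [b [aw bw ab]]].
rewrite sum1_card -(card_alphabet_class aw bw ab); apply: eq_card => u.
rewrite unfold_in /= alphabet_class_eqP andb_idl //.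
exact/subsetP/common_words_class.
Qed.

Theorem theorem12 (n : nat) (T : btree) (l : nat) :
  2 <= n -> nb_leaves T = n -> l = level (leaf T 1) ->
  #|ParseWords n T (LeftCombTree n)| = 2 ^ (l - 1).
Proof.
move=> n_ge2 sizeT lE; apply/eqP; rewrite -(eqn_pmul2r (m := 6)) //.
rewrite -card_common_words_classes // card_common_words ?(ltnW n_ge2) // -lE.
(* It remains to compare [3 * 2 ^ l] with [2 ^ (l - 1) * 6]. The subtraction is truncated, so [l]
   must be positive: a tree with at least two leaves has an internal root. *)
have l_gt0 : 0 < l.
  by move: sizeT lE n_ge2; case: T => [<-|L R _ ->] //; rewrite level_leaf1_Node.
by rewrite -{1}(subnK l_gt0) expnD mulnC -mulnA.
Qed.
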